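(* Let ${\sf FinBranch}$ be the following formula about a tree $T\subseteq\omega^{<\omega}$: $$\forall\sigma\in T\ \exists k\ \ |\{n\in\omega:\sigma^\frown n\in T\}|\le k.$$ Then ${\sf FinBranch}$ is $\forall\forall^\infty\forall$-dicomplete.
   Context: Quantifiers range over $\omega$. $\exists^\infty n\,\varphi(n)$ means $\forall m\exists n\ge m\,\varphi(n)$ and $\forall^\infty n\,\varphi(n)$ means $\exists m\forall n\ge m\,\varphi(n)$. A quantifier-pattern is a finite string $\bar{\mathsf Q}=\mathsf Q_0\dots\mathsf Q_\ell$ over $\{\exists,\forall,\exists^\infty,\forall^\infty\}$. A $\bar{\mathsf Q}$-formula is $\varphi(\bar x)\equiv\mathsf Q_0n_0\dots\mathsf Q_\ell n_\ell\,\theta(n_0,\dots,n_\ell,\bar x)$ with $\theta$ a bounded formula. The instance $\bar x$ is a tuple of natural numbers and/or total computable functions (computable elements of $\omega^\omega$). Spaces such as $\omega\times\omega^\omega$, $(\omega^\omega)^\omega$, $\omega^{\omega\times\omega}$ are identified with $\omega^\omega$ by computable pairing. Witnesses: for $\alpha\in\omega^\omega$, $\alpha\Vdash\varphi(\bar x)$ (''$\alpha$ is a witness for $\varphi(\bar x)$'') is defined by: $\alpha\Vdash\theta(\bar x)$ iff $\alpha=\bar x$ and $\theta(\bar x)$, for bounded $\theta$; $\langle t,\alpha\rangle\Vdash\exists n\varphi(n,\bar x)$ iff $\alpha\Vdash\varphi(t,\bar x)$; $\alpha\Vdash\forall n\varphi(n,\bar x)$ iff $\alpha(n)\Vdash\varphi(n,\bar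 x)$ for all $n$; $\langle t,\alpha\rangle\Vdash\forall^\infty n\varphi(n,\bar x)$ iff $\alpha(n)\Vdash\varphi(n,\bar x)$ for all $n\ge t$; $\alpha\Vdash\exists^\infty n\varphi(n,\bar x)$ iff for all $n$, writing $\alpha(n)=\langle k,\beta\rangle$, $k\ge n$ and $\beta\Vdash\varphi(k,\bar x)$. Reducibility: $\varphi\le_{\sf m}\psi$ if there are computable functions $\eta,r_-,r_+$ (type-two computable functionals, possibly partial but defined wherever required) such that for every instance $\bar x$: $\varphi(\bar x)$ is true iff $\psi(\eta(\bar x))$ is true; $\alpha\Vdash\varphi(\bar x)$ implies $r_-(\alpha,\bar x)\Vdash\psi(\eta(\bar x))$; $\alpha\Vdash\psi(\eta(\bar x))$ implies $r_+(\alpha,\bar x)\Vdash\varphi(\bar x)$ ($\alpha\in\omega^\omega$ arbitrary). The dual $\varphi^{\sf d}$ of $\mathsf Q_0n_0\dots\mathsf Q_\ell n_\ell\,\theta$ is $\mathsf Q_0^{\sf d}n_0\dots\mathsf Q_\ell^{\sf d}n_\ell\,\neg\theta$, where $\exists^{\sf d}=\forall$, $\forall^{\sf d}=\exists$, $(\exists^\infty)^{\sf d}=\forall^\infty$, $(\forall^\infty)^{\sf d}=\exists^\infty$. $\varphi\le_{\sf dm}\psi$ if $\varphi\le_{\sf m}\psi$ and $\varphi^{\sf d}\le_{\sf m}\psi^{\sf d}$ via a common $\eta$ (the $r_\pm$ may differ). $\varphi$ is strictly $\bar{\mathsf Q}$-dicomplete if it is a $\bar{\mathsf Q}$-formula and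 $\psi\le_{\sf dm}\varphi$ for every $\bar{\mathsf Q}$-formula $\psi$; it is $\bar{\mathsf Q}$-dicomplete if it is $\equiv_{\sf dm}$-equivalent to a strictly $\bar{\mathsf Q}$-dicomplete formula (one such is $\mathsf Q_0n_0\dots\mathsf Q_\ell n_\ell.\ x(n_0,\dots,n_\ell)=0$). Structures: a tree is a subset $T\subseteq\omega^{<\omega}$ (finite sequences, coded by natural numbers) closed under initial segments, given by its characteristic function. Instances of ${\sf FinBranch}$ are (computable) codes of trees; reductions from it need only work on such codes and reductions to it must output such codes. $\sigma^\frown n$ is $\sigma$ extended by the entry $n$. Restricted quantifiers mean $\forall\sigma(\sigma\in T\to\cdots)$ etc., with decidable conditions moved into the innermost bounded part. For a set $A$, $|A|\le k$ abbreviates $\forall c_0,\dots,c_k\in A\ \exists i,j\le k\,(i\ne j\wedge c_i=c_j)$, where the block $\forall c_0,\dots,c_k$ is one universal quantifier over coded tuples. *)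

(* Defs.v *)
From Stdlib Require Cantor.
From mathcomp Require Import all_boot.

Set Implicit Arguments.
Unset Strict Implicit.
Unset Printing Implicit Defensive.

(** * Pairings of natural numbers and of elements of Baire space *)

Definition pairn (m n : nat) : nat := Cantor.to_nat (m, n).
Definition fstn (p : nat) : nat := (Cantor.of_nat p).1.
Definition sndn (p : nat) : nat := (Cantor.of_nat p).2.

Lemma pairnK m n : (fstn (pairn m n) = m) * (sndn (pairn m n) = n).
Proof. by rewrite /fstn /sndn /pairn Cantor.cancel_of_to. Qed.

Lemma fst_sndnK p : pairn (fstn p) (sndn p) = p.
Proof.
by rewrite /fstn /sndn /pairn -surjective_pairing Cantor.cancel_to_of.
Qed.

Definition baire := nat -> nat.

(* An element a of Baire space read through nat * baire = baire is the pair
   (a 0, tail a); read through baire ^ nat = baire it is the sequence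
   (row a n)_n. *)
Definition tail (a : baire) : baire := fun m => a m.+1.
Definition row (a : baire) (n : nat) : baire := fun m => a (pairn n m).
Definition consb (t : nat) (a : baire) : baire :=
  fun m => if m is m'.+1 then a m' else t.
Definition joinb (a b : baire) : baire :=
  fun m => if odd m then b m./2 else a m./2.

(** * Instances: tuples of numbers and of functions *)

Record instance := Instance { nums : seq nat; funs : seq baire }.

Definition fun_nth (fs : seq baire) (j : nat) : baire :=
  nth (fun=> 0) fs j.

(* For fixed lengths of the two lists this is injective up to =1. *)
Definition encode (x : instance) : baire :=
  foldr consb (fun m => fun_nth (funs x) (fstn m) (sndn m)) (nums x).

Definition add_num (x : instance) (n : nat) : instance :=
  Instance (rcons (nums x) n) (funs x).

(** * Computability relative to an oracle *)

Inductive code :=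
  | CZero | CSucc | CFst | CSnd | COracle
  | CPair of code & code
  | CComp of code & code
  | CRec of code & code
  | CMu of code.

(* eval o c n m : the program c with oracle o halts on input n with output m *)
Inductive eval (o : baire) : code -> nat -> nat -> Prop :=
  | eval_zero n : eval o CZero n 0
  | eval_succ n : eval o CSucc n n.+1
  | eval_fst n : eval o CFst n (fstn n)
  | eval_snd n : eval o CSnd n (sndn n)
  | eval_oracle n : eval o COracle n (o n)
  | eval_pair c d n a b :
      eval o c n a -> eval o d n b -> eval o (CPair c d) n (pairn a b)
  | eval_comp c d n a b :
      eval o d n a -> eval o c a b -> eval o (CComp c d) n b
  | eval_rec0 c d z a :
      eval o c z a -> eval o (CRec c d) (pairn z 0) a
  | eval_recS c d z y a b :
      eval o (CRec c d) (pairn z y) a ->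
      eval o d (pairn z (pairn y a)) b ->
      eval o (CRec c d) (pairn z y.+1) b
  | eval_mu c z y (w : nat -> nat) :
      (forall i, i < y -> eval o c (pairn z i) (w i).+1) ->
      eval o c (pairn z y) 0 ->
      eval o (CMu c) z y.

(* The partial computable functional with program c is defined at a with
   value b. *)
Definition maps_to (c : code) (a b : baire) : Prop :=
  forall n, eval a c n (b n).

Definition computable (f : baire) : Prop :=
  exists c, maps_to c (fun=> 0) f.

(** * Bounded formulas *)

(* Unary primitive recursive functions; other arities go through pairn. *)
Inductive primrec : (nat -> nat) -> Prop :=
  | primrec_zero : primrec (fun=> 0)
  | primrec_succ : primrec succn
  | primrec_fst : primrec fstn
  | primrec_snd : primrec sndn
  | primrec_pair f g :
      primrec f -> primrec g -> primrec (fun n => pairn (f n) (g n))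
  | primrec_comp f g : primrec f -> primrec g -> primrec (fun n => f (g n))
  | primrec_rec f g :
      primrec f -> primrec g ->
      primrec (fun p =>
        nat_rec (fun=> nat) (f (fstn p))
          (fun y r => g (pairn (fstn p) (pairn y r))) (sndn p))
  | primrec_ext f g : f =1 g -> primrec f -> primrec g.

(* The language of arithmetic with a symbol for every primitive recursive
   function and with variables for functions.  [Var i] is the i-th number
   variable, [App j t] the j-th function variable applied to t. *)
Inductive term :=
  | Var of nat
  | Cst of nat
  | Pair of term & term
  | Prim f of primrec f & term
  | App of nat & term.

(* [BAll t b] and [BEx t b] are the quantifiers "for all i <= t" and "for some
   i <= t".  Number variables are de Bruijn levels: a quantifier, bounded or
   not, binds the next unused index, so that the indices of the variables
   already in scope never change. *)
Inductive bform :=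
  | Eq of term & term
  | Not of bform
  | And of bform & bform
  | Or of bform & bform
  | Imp of bform & bform
  | BAll of term & bform
  | BEx of term & bform.

Fixpoint teval (x : instance) (t : term) : nat :=
  match t with
  | Var i => nth 0 (nums x) i
  | Cst n => n
  | Pair t u => pairn (teval x t) (teval x u)
  | Prim f _ t => f (teval x t)
  | App j t => fun_nth (funs x) j (teval x t)
  end.

Fixpoint beval (x : instance) (b : bform) : bool :=
  match b with
  | Eq t u => teval x t == teval x u
  | Not b => ~~ beval x b
  | And b c => beval x b && beval x c
  | Or b c => beval x b || beval x c
  | Imp b c => beval x b ==> beval x c
  | BAll t b => all (fun i => beval (add_num x i) b) (iota 0 (teval x t).+1)
  | BEx t b => has (fun i => beval (add_num x i) b) (iota 0 (teval x t).+1)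
  end.

(** * Formulas with a quantifier prefix: truth, witnesses, duals *)

Inductive quant := Ex | All | ExInf | AllInf.

Fixpoint holds (qs : seq quant) (b : bform) (x : instance) : Prop :=
  match qs with
  | [::] => beval x b
  | Ex :: qs => exists n, holds qs b (add_num x n)
  | All :: qs => forall n, holds qs b (add_num x n)
  | ExInf :: qs => forall m, exists n, m <= n /\ holds qs b (add_num x n)
  | AllInf :: qs => exists m, forall n, m <= n -> holds qs b (add_num x n)
  end.

Fixpoint witness (qs : seq quant) (b : bform) (x : instance) (a : baire)
    : Prop :=
  match qs with
  | [::] => a =1 encode x /\ beval x b
  | Ex :: qs => witness qs b (add_num x (a 0)) (tail a)
  | All :: qs => forall n, witness qs b (add_num x n) (row a n)
  | AllInf :: qs =>
      forall n, a 0 <= n -> witness qs b (add_num x n) (row (tail a) n)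
  | ExInf :: qs =>
      forall n, n <= row a n 0 /\
        witness qs b (add_num x (row a n 0)) (tail (row a n))
  end.

(* A formula about tuples of n_num numbers and n_fun computable functions;
   [domain] restricts its instances further, e.g. to codes of trees.  The
   parameters are the number variables 0, ..., n_num - 1, the i-th quantifier
   of the prefix binds the number variable n_num + i. *)
Record formula := Formula {
  prefix : seq quant;
  matrix : bform;
  n_num : nat;
  n_fun : nat;
  domain : instance -> Prop
}.

Definition is_instance (p : formula) (x : instance) : Prop :=
  [/\ size (nums x) = n_num p, size (funs x) = n_fun p,
      forall j, j < n_fun p -> computable (fun_nth (funs x) j)
    & domain p x].

Definition true_at (p : formula) : instance -> Prop :=
  holds (prefix p) (matrix p).

Definition witnesses (a : baire) (p : formula) (x : instance) : Prop :=
  witness (prefix p) (matrix p) x a.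

Definition dualq (q : quant) : quant :=
  match q with
  | Ex => All | All => Ex | ExInf => AllInf | AllInf => ExInf
  end.

Definition dual (p : formula) : formula :=
  Formula (map dualq (prefix p)) (Not (matrix p)) (n_num p) (n_fun p)
    (domain p).

(** * Reducibility and completeness *)

Definition reduces_via (eta : code) (p q : formula) : Prop :=
  exists rm rp : code, forall x, is_instance p x ->
    exists y, [/\ is_instance q y,
      maps_to eta (encode x) (encode y),
      true_at p x <-> true_at q y,
      forall a, witnesses a p x ->
        exists b, maps_to rm (joinb a (encode x)) b /\ witnesses b q y
    & forall a, witnesses a q y ->
        exists b, maps_to rp (joinb a (encode x)) b /\ witnesses b p x].

Definition m_reducible (p q : formula) : Prop :=
  exists eta, reduces_via eta p q.

Definition dm_reducible (p q : formula) : Prop :=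
  exists eta, reduces_via eta p q /\ reduces_via eta (dual p) (dual q).

Definition dm_equivalent (p q : formula) : Prop :=
  dm_reducible p q /\ dm_reducible q p.

Definition is_Qformula (Q : seq quant) (p : formula) : Prop :=
  prefix p = Q /\ forall x, domain p x.

Definition strictly_dicomplete (Q : seq quant) (p : formula) : Prop :=
  is_Qformula Q p /\ forall r, is_Qformula Q r -> dm_reducible r p.

Definition dicomplete (Q : seq quant) (p : formula) : Prop :=
  exists r, strictly_dicomplete Q r /\ dm_equivalent p r.

(** * Trees and the formula FinBranch *)

Definition snoc (s n : nat) : nat := (pairn s n).+1.

(* A bijection between finite sequences and numbers, with
   seq_code (rcons s n) = snoc (seq_code s) n. *)
Definition seq_code (s : seq nat) : nat := foldl snoc 0 s.

Definition is_tree (T : baire) : Prop :=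
  (forall m, T m <= 1) /\
  (forall s u : seq nat, T (seq_code (s ++ u)) = 1 -> T (seq_code s) = 1).

(* Every number c codes, for every k, the tuple (entry c 0, ..., entry c k);
   every tuple has a code. *)
Definition entry (c i : nat) : nat := fstn (iter i sndn c).

Lemma entry_surj (s : seq nat) :
  exists c, forall i, i < size s -> entry c i = nth 0 s i.
Proof.
elim: s => [|a s [c IHs]]; first by exists 0.
exists (pairn a c) => -[|i] /= lt_i; first by rewrite /entry /= pairnK.
by rewrite -IHs // /entry iterSr pairnK.
Qed.

Lemma primrec_entry : primrec (fun p => entry (fstn p) (sndn p)).
Proof.
have snd_r : primrec (fun m => sndn (sndn (sndn m))).
  by do 2![apply: (primrec_comp primrec_snd)]; apply: primrec_snd.
have id_r : primrec id.
  apply: (primrec_ext fst_sndnK).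
  by apply: primrec_pair; [apply: primrec_fst | apply: primrec_snd].
have := primrec_comp primrec_fst (primrec_rec id_r snd_r).
apply: primrec_ext => p; rewrite /entry; congr fstn.
by elim: (sndn p) => //= i ->; rewrite !pairnK.
Qed.

Definition tentry (c i : term) : term := Prim primrec_entry (Pair c i).
Definition tsnoc (s n : term) : term := Prim primrec_succ (Pair s n).
Definition in_tree (s : term) : bform := Eq (App 0 s) (Cst 1).

(* for all s in T, there is k, such that for all tuples c,
   c_0, ..., c_k in {n | snoc s n in T} -> exists i, j <= k,
   i != j and c_i = c_j *)
Definition FinBranch : formula :=
  let s := Var 0 in let k := Var 1 in let c := Var 2 in
  let i := Var 3 in let j := Var 4 in
  Formula [:: All; Ex; All]
    (Imp (in_tree s)
      (Imp (BAll k (in_tree (tsnoc s (tentry c i))))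
        (BEx k (BEx k (And (Not (Eq i j)) (Eq (tentry c i) (tentry c j)))))))
    0 1 (fun x => is_tree (fun_nth (funs x) 0)).

(* Main.v *)
From Stdlib Require Cantor.
From Stdlib Require Import FunctionalExtensionality.
Require Import Defs.
From mathcomp Require Import all_boot.
From mathcomp Require Import zify.

Set Implicit Arguments.
Unset Strict Implicit.
Unset Printing Implicit Defensive.

(* Let FinBranch' have the matrix of FinBranch and the prefix All AllInf All.
   The matrix is monotone in k, so the identity reduces FinBranch to FinBranch',
   and it is enough to reduce to FinBranch every formula
   All a, AllInf b, All c, ~~ bad a b c.

   The tree for the latter has the spine 0^a, a in nat.  Besides 0^(a+1), the
   node 0^a has, for every i, the child 1 + <i, e> when e = <b, c> is the first
   pair with bad a b c and i <= b; these children are leaves.  If bad a b c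
   entails b < t, then 0^a has at most t + 1 children; conversely, if bad a b c
   holds, then the children for i <= b show that 0^a has more than b + 1 of
   them.  Having one child for each i <= b, rather than one for each bad b, is
   what lets a bound on the number of children give back a bound on b.  All the
   functionals involved are primitive recursive: every search is bounded. *)

Local Notation add_num3 x a b c := (add_num (add_num (add_num x a) b) c).

(** * Computable functionals *)

Definition unrow (G : nat -> baire) : baire := fun m => G (fstn m) (sndn m).

Lemma unrowE G n m : unrow G (pairn n m) = G n m.
Proof. by rewrite /unrow !pairnK. Qed.

Lemma encodeE x m :
  encode x m = if m < size (nums x) then nth 0 (nums x) m
               else fun_nth (funs x) (fstn (m - size (nums x)))
                                     (sndn (m - size (nums x))).
Proof.
rewrite /encode; case: x => /= ns fs.
by elim: ns m => [|n ns IHn] [|m] //=; rewrite IHn ltnS subSS.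
Qed.

(* The functionals computed, by one program for all i, from the oracle o i. *)
Definition ucomp (I : Type) (o : I -> baire) (F : I -> nat -> nat) : Prop :=
  exists c, forall i, maps_to c (o i) (F i).

(** Composition of partial functionals: every oracle call of [c] is answered by running [g]. *)
Fixpoint subst_oracle (g c : code) : code :=
  match c with
  | COracle => g
  | CPair c d => CPair (subst_oracle g c) (subst_oracle g d)
  | CComp c d => CComp (subst_oracle g c) (subst_oracle g d)
  | CRec c d => CRec (subst_oracle g c) (subst_oracle g d)
  | CMu c => CMu (subst_oracle g c)
  | c => c
  end.

Lemma maps_to_subst g c o f h :
  maps_to g o f -> maps_to c f h -> maps_to (subst_oracle g c) o h.
Proof.
move=> og fc n; have := fc n; move: (h n) => {fc} b; elim=> {c n b} /=.
- exact: eval_zero.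
- exact: eval_succ.
- exact: eval_fst.
- exact: eval_snd.
- exact: og.
- by move=> *; apply: eval_pair.
- by move=> c d n a b _ IHd _ IHc; apply: eval_comp IHd IHc.
- by move=> *; apply: eval_rec0.
- by move=> c d z y a b _ IHc _ IHd; apply: eval_recS IHc IHd.
- by move=> c z y w _ IHw _ IHc; apply: eval_mu IHw IHc.
Qed.

Section Closure.
Variables (I : Type) (o : I -> baire).
Implicit Types F G H : I -> nat -> nat.
Implicit Types B C : I -> nat -> bool.

Lemma ucomp_ext F G : F =2 G -> ucomp o F -> ucomp o G.
Proof. by move=> eqFG [c oF]; exists c => i n; rewrite -eqFG; apply: oF. Qed.

Lemma ucomp_id : ucomp o (fun _ n => n).
Proof.
exists (CPair CFst CSnd) => i n; rewrite -{2}[n]fst_sndnK.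
exact: eval_pair (eval_fst _ _) (eval_snd _ _).
Qed.

Lemma ucomp_succ F : ucomp o F -> ucomp o (fun i n => (F i n).+1).
Proof.
case=> c oF; exists (CComp CSucc c) => i n.
exact: eval_comp (oF i n) (eval_succ _ _).
Qed.

Lemma ucomp_fst F : ucomp o F -> ucomp o (fun i n => fstn (F i n)).
Proof.
case=> c oF; exists (CComp CFst c) => i n.
exact: eval_comp (oF i n) (eval_fst _ _).
Qed.

Lemma ucomp_snd F : ucomp o F -> ucomp o (fun i n => sndn (F i n)).
Proof.
case=> c oF; exists (CComp CSnd c) => i n.
exact: eval_comp (oF i n) (eval_snd _ _).
Qed.

Lemma ucomp_oracle F : ucomp o F -> ucomp o (fun i n => o i (F i n)).
Proof.
case=> c oF; exists (CComp COracle c) => i n.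
exact: eval_comp (oF i n) (eval_oracle _ _).
Qed.

Lemma ucomp_pair F G :
  ucomp o F -> ucomp o G -> ucomp o (fun i n => pairn (F i n) (G i n)).
Proof.
case=> c oF [d oG]; exists (CPair c d) => i n.
exact: eval_pair (oF i n) (oG i n).
Qed.

Lemma ucomp_comp F G : ucomp o F -> ucomp o G -> ucomp o (fun i n => F i (G i n)).
Proof.
case=> c oF [d oG]; exists (CComp c d) => i n.
exact: eval_comp (oG i n) (oF i _).
Qed.

Lemma ucomp_comp2 (F : I -> nat -> nat -> nat) G H :
    ucomp o (fun i p => F i (fstn p) (sndn p)) -> ucomp o G -> ucomp o H ->
  ucomp o (fun i n => F i (G i n) (H i n)).
Proof.
move=> oF oG oH; have := ucomp_comp oF (ucomp_pair oG oH).
by apply: ucomp_ext => i n; rewrite !pairnK.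
Qed.

Lemma ucomp_const k : ucomp o (fun _ _ => k).
Proof.
elim: k => [|k IHk]; first by exists CZero => i n; constructor.
exact: ucomp_succ IHk.
Qed.

Lemma ucomp_rec F (G : I -> nat -> nat -> nat -> nat) H :
    ucomp o F ->
    ucomp o (fun i p => G i (fstn p) (fstn (sndn p)) (sndn (sndn p))) ->
    ucomp o H ->
  ucomp o (fun i n => nat_rec (fun=> nat) (F i n) (G i n) (H i n)).
Proof.
case=> f oF [g oG] oH.
(* Programs take a single number, so the argument [n] becomes the parameter [z] of the recursion and
   [H] is composed in afterwards. *)
apply: (@ucomp_comp2 (fun i z y => nat_rec _ (F i z) (G i z) y)) => //; last first.
  exact: ucomp_id.
exists (CRec f g) => i p; rewrite -{1}[p]fst_sndnK.
elim: (sndn p) => [|y IHy] /=; first exact/eval_rec0/oF.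
apply: eval_recS IHy _; have := oG i (pairn (fstn p) (pairn y
  (nat_rec (fun=> nat) (F i (fstn p)) (G i (fstn p)) y))).
by rewrite !pairnK.
Qed.

Lemma ucomp_if B F G :
    ucomp o B -> ucomp o F -> ucomp o G ->
  ucomp o (fun i n => if B i n then F i n else G i n).
Proof.
move=> oB oF oG.
have: ucomp o (fun i n =>
    nat_rec (fun=> nat) (G i n) (fun _ _ => F i n) (B i n)).
  apply: ucomp_rec => //; exact: (ucomp_comp oF (ucomp_fst ucomp_id)).
by apply: ucomp_ext => i n; case: (B i n).
Qed.

Lemma ucomp_neg B : ucomp o B -> ucomp o (fun i n => ~~ B i n).
Proof.
move=> oB; have := ucomp_if oB (ucomp_const 0) (ucomp_const 1).
by apply: ucomp_ext => i n; case: (B i n).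
Qed.

Lemma ucomp_and B C : ucomp o B -> ucomp o C -> ucomp o (fun i n => B i n && C i n).
Proof.
move=> oB oC; have := ucomp_if oB oC (ucomp_const 0).
by apply: ucomp_ext => i n; case: (B i n).
Qed.

Lemma ucomp_or B C : ucomp o B -> ucomp o C -> ucomp o (fun i n => B i n || C i n).
Proof.
move=> oB oC; have := ucomp_if oB (ucomp_const 1) oC.
by apply: ucomp_ext => i n; case: (B i n).
Qed.

Lemma ucomp_imp B C : ucomp o B -> ucomp o C -> ucomp o (fun i n => B i n ==> C i n).
Proof.
move=> oB oC; have := ucomp_if oB oC (ucomp_const 1).
by apply: ucomp_ext => i n; case: (B i n).
Qed.

Lemma ucomp_pred F : ucomp o F -> ucomp o (fun i n => (F i n).-1).
Proof.
move=> oF; have: ucomp o (fun i n => nat_rec (fun=> nat) 0 (fun y _ => y) (F i n)).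
  apply: ucomp_rec oF; [exact: ucomp_const|exact/ucomp_fst/ucomp_snd/ucomp_id].
by apply: ucomp_ext => i n; case: (F i n).
Qed.

Lemma ucomp_sub F G : ucomp o F -> ucomp o G -> ucomp o (fun i n => F i n - G i n).
Proof.
move=> oF oG.
have: ucomp o (fun i n => nat_rec (fun=> nat) (F i n) (fun _ r => r.-1) (G i n)).
  apply: ucomp_rec oG => //; exact/ucomp_pred/ucomp_snd/ucomp_snd/ucomp_id.
apply: ucomp_ext => i n; elim: (G i n) => [|m /= ->]; first by rewrite subn0.
by rewrite subnS.
Qed.

Lemma ucomp_add F G : ucomp o F -> ucomp o G -> ucomp o (fun i n => F i n + G i n).
Proof.
move=> oF oG.
have: ucomp o (fun i n => nat_rec (fun=> nat) (G i n) (fun _ r => r.+1) (F i n)).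
  apply: ucomp_rec oF => //; exact/ucomp_succ/ucomp_snd/ucomp_snd/ucomp_id.
by apply: ucomp_ext => i n; elim: (F i n) => [|m /= ->].
Qed.

Lemma ucomp_leq F G : ucomp o F -> ucomp o G -> ucomp o (fun i n => F i n <= G i n).
Proof.
move=> oF oG.
have: ucomp o (fun i n => 1 - (F i n - G i n)).
  exact: ucomp_sub (ucomp_const _) (ucomp_sub _ _).
by apply: ucomp_ext => i n; rewrite /leq; case: (F i n - G i n).
Qed.

Lemma ucomp_eq F G : ucomp o F -> ucomp o G -> ucomp o (fun i n => F i n == G i n).
Proof.
move=> oF oG; have := ucomp_and (ucomp_leq oF oG) (ucomp_leq oG oF).
by apply: ucomp_ext => i n; rewrite eqn_leq.
Qed.

Lemma ucomp_odd F : ucomp o F -> ucomp o (fun i n => odd (F i n)).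
Proof.
move=> oF.
have: ucomp o (fun i n => nat_rec (fun=> nat) 0 (fun _ r => 1 - r) (F i n)).
  apply: ucomp_rec oF; first exact: ucomp_const.
  exact: ucomp_sub (ucomp_const _) (ucomp_snd (ucomp_snd ucomp_id)).
by apply: ucomp_ext => i n; elim: (F i n) => //= m ->; case: (odd m).
Qed.

Lemma ucomp_half F : ucomp o F -> ucomp o (fun i n => (F i n)./2).
Proof.
move=> oF.
have: ucomp o (fun i n => nat_rec (fun=> nat) 0 (fun y r => odd y + r) (F i n)).
  apply: ucomp_rec oF; first exact: ucomp_const.
  apply: ucomp_add; first exact/ucomp_odd/ucomp_fst/ucomp_snd/ucomp_id.
  exact/ucomp_snd/ucomp_snd/ucomp_id.
by apply: ucomp_ext => i n; elim: (F i n) => //= m ->; rewrite uphalf_half.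
Qed.

Lemma ucomp_find (B : I -> nat -> nat -> bool) H :
    ucomp o (fun i p => B i (fstn p) (sndn p)) -> ucomp o H ->
  ucomp o (fun i n => find (B i n) (iota 0 (H i n))).
Proof.
move=> oB oH.
(* The counter [r] keeps up with [y] until the first hit; from then on it stays behind and is
   frozen. *)
have: ucomp o (fun i n => nat_rec (fun=> nat) 0
    (fun y r => if (r == y) && ~~ B i n y then r.+1 else r) (H i n)).
  have oR := ucomp_snd (ucomp_snd ucomp_id).
  have oY := ucomp_fst (ucomp_snd ucomp_id).
  apply: ucomp_rec oH; first exact: ucomp_const.
  apply: (ucomp_if _ (ucomp_succ oR) oR).
  apply: (ucomp_and (ucomp_eq oR oY) (ucomp_neg _)).
  exact: (@ucomp_comp2 (fun i n y => B i n y)) (ucomp_fst ucomp_id) oY.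
apply: ucomp_ext => i n; elim: (H i n) => // m IHm; rewrite [LHS]/= {}IHm.
have := find_size (B i n) (iota 0 m).
rewrite -[m.+1]addn1 iotaD add0n find_cat has_find size_iota /=.
move: (find _ _) => r; rewrite leq_eqVlt; case: eqVneq => [-> _ | _ /= ->] //.
by rewrite ltnn; case: (B i n m); rewrite ?addn0 ?addn1.
Qed.

Lemma ucomp_has (B : I -> nat -> nat -> bool) H :
    ucomp o (fun i p => B i (fstn p) (sndn p)) -> ucomp o H ->
  ucomp o (fun i n => has (B i n) (iota 0 (H i n))).
Proof.
move=> oB oH; have := ucomp_leq (ucomp_succ (ucomp_find oB oH)) oH.
by apply: ucomp_ext => i n; rewrite has_find size_iota.
Qed.

Lemma ucomp_all (B : I -> nat -> nat -> bool) H :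
    ucomp o (fun i p => B i (fstn p) (sndn p)) -> ucomp o H ->
  ucomp o (fun i n => all (B i n) (iota 0 (H i n))).
Proof.
move=> oB oH.
have := ucomp_neg (@ucomp_has (fun i n j => ~~ B i n j) _ (ucomp_neg oB) oH).
by apply: ucomp_ext => i n; rewrite (has_predC (B i n)) negbK.
Qed.

Lemma ucomp_consb F (G : I -> nat -> baire) H :
    ucomp o F -> ucomp o (fun i p => G i (fstn p) (sndn p)) -> ucomp o H ->
  ucomp o (fun i n => consb (F i n) (G i n) (H i n)).
Proof.
move=> oF oG oH.
have := ucomp_if (ucomp_eq oH (ucomp_const 0)) oF
          (ucomp_comp2 oG ucomp_id (ucomp_pred oH)).
by apply: ucomp_ext => i n; case: (H i n).
Qed.

Lemma ucomp_unrow (G : I -> nat -> nat -> baire) H :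
    ucomp o (fun i p => G i (fstn p) (fstn (sndn p)) (sndn (sndn p))) ->
    ucomp o H ->
  ucomp o (fun i n => unrow (G i n) (H i n)).
Proof.
move=> oG oH; have := ucomp_comp oG (ucomp_pair ucomp_id oH).
by apply: ucomp_ext => i n; rewrite !pairnK.
Qed.

Lemma ucomp_primrec f F : primrec f -> ucomp o F -> ucomp o (fun i n => f (F i n)).
Proof.
move=> prf; suff of_: ucomp o (fun=> f) by apply: ucomp_comp of_.
elim: prf => {f F}.
- exact: ucomp_const.
- exact: ucomp_succ ucomp_id.
- exact: ucomp_fst ucomp_id.
- exact: ucomp_snd ucomp_id.
- by move=> f g _ of_ _ og; apply: ucomp_pair.
- by move=> f g _ of_ _ og; apply: ucomp_comp of_ og.
- move=> f g _ of_ _ og; apply: ucomp_rec.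
  + exact: ucomp_comp of_ (ucomp_fst ucomp_id).
  + apply/(ucomp_comp og)/ucomp_pair; first exact/ucomp_fst/ucomp_fst/ucomp_id.
    by apply: ucomp_ext (ucomp_snd ucomp_id) => i n; rewrite fst_sndnK.
  + exact: ucomp_snd ucomp_id.
- by move=> f g fg _; apply: ucomp_ext => i n; apply: fg.
Qed.

End Closure.

(** Closure facts put into the context supply the functions that the general lemmas do not cover. *)
Ltac ucomp_step := first
  [ assumption | simple apply ucomp_id | simple apply ucomp_const
  | match goal with H : _ |- ucomp _ _ => simple apply H end
  | simple apply ucomp_succ | simple apply ucomp_fst | simple apply ucomp_snd
  | simple apply ucomp_pair | simple apply ucomp_if | simple apply ucomp_neg
  | simple apply ucomp_and | simple apply ucomp_or | simple apply ucomp_imp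
  | simple apply ucomp_pred | simple apply ucomp_sub | simple apply ucomp_add
  | simple apply ucomp_leq | simple apply ucomp_eq | simple apply ucomp_odd
  | simple apply ucomp_half | simple apply ucomp_find | simple apply ucomp_has
  | simple apply ucomp_all | simple apply ucomp_consb
  | simple apply ucomp_unrow | simple apply ucomp_rec
  | simple apply ucomp_primrec ].
Ltac ucomp := solve [repeat ucomp_step].

(** * Evaluation of bounded formulas *)

Section Instances.
Variables (I : Type) (o : I -> baire).
Implicit Types (d : nat) (Y : I -> nat -> instance).

(** The argument [n] carries the values of quantified variables, so the instance depends on it. The
    length [d] is fixed, since the layout of [encode] depends on it and [add_num] writes at index
    [d]. *)
Definition uinst d Y : Prop :=
  [/\ forall i n, size (nums (Y i n)) = d,
      ucomp o (fun i p => nth 0 (nums (Y i (fstn p))) (sndn p))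
    & ucomp o (fun i p =>
        fun_nth (funs (Y i (fstn p))) (fstn (sndn p)) (sndn (sndn p)))].

Lemma uinst_comp d Y G :
  uinst d Y -> ucomp o G -> uinst d (fun i n => Y i (G i n)).
Proof.
case=> sY nY fY oG; have oH : ucomp o (fun i p => pairn (G i (fstn p)) (sndn p)).
  by apply: ucomp_pair; [apply: (ucomp_comp oG)|]; ucomp.
split=> //; first by apply: ucomp_ext (ucomp_comp nY oH) => i n; rewrite !pairnK.
by apply: ucomp_ext (ucomp_comp fY oH) => i n; rewrite !pairnK.
Qed.

Lemma ucomp_fun_nth d Y F G :
    uinst d Y -> ucomp o F -> ucomp o G ->
  ucomp o (fun i n => fun_nth (funs (Y i n)) (F i n) (G i n)).
Proof.
case=> sY nY fY oF oG.
have oH := ucomp_pair (ucomp_id o) (ucomp_pair oF oG).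
by apply: ucomp_ext (ucomp_comp fY oH) => i n; rewrite !pairnK.
Qed.

Lemma ucomp_nth_nums d Y F :
    uinst d Y -> ucomp o F -> ucomp o (fun i n => nth 0 (nums (Y i n)) (F i n)).
Proof.
case=> sY nY fY oF; have := ucomp_comp nY (ucomp_pair (ucomp_id o) oF).
by apply: ucomp_ext => i n; rewrite !pairnK.
Qed.

Lemma uinst_add d Y F :
  uinst d Y -> ucomp o F -> uinst d.+1 (fun i n => add_num (Y i n) (F i n)).
Proof.
case=> sY nY fY oF; split=> //; first by move=> i n; rewrite size_rcons sY.
have oF' : ucomp o (fun i p => F i (fstn p)) by apply: (ucomp_comp oF); ucomp.
have: ucomp o (fun i p =>
  if sndn p < d then nth 0 (nums (Y i (fstn p))) (sndn p)
  else if sndn p == d then F i (fstn p) else 0) by ucomp.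
by apply: ucomp_ext => i n; rewrite nth_rcons sY.
Qed.

Lemma ucomp_encode d Y F :
  uinst d Y -> ucomp o F -> ucomp o (fun i n => encode (Y i n) (F i n)).
Proof.
move=> oY oF; have nY := ucomp_nth_nums oY oF.
have fY := ucomp_fun_nth oY (ucomp_fst (ucomp_sub oF (ucomp_const o d)))
                            (ucomp_snd (ucomp_sub oF (ucomp_const o d))).
have := ucomp_if (ucomp_leq (ucomp_succ oF) (ucomp_const o d)) nY fY.
by apply: ucomp_ext => i n; case: oY => sY _ _; rewrite encodeE sY.
Qed.

Lemma ucomp_teval d Y t : uinst d Y -> ucomp o (fun i n => teval (Y i n) t).
Proof.
move=> oY; elim: t => [k|k|t IHt u IHu|f prf t IHt|j t IHt] /=; try by ucomp.
  by apply: (ucomp_nth_nums oY); ucomp.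
by apply: (ucomp_fun_nth oY); ucomp.
Qed.

Lemma ucomp_beval d Y b : uinst d Y -> ucomp o (fun i n => beval (Y i n) b).
Proof.
elim: b d Y => [t u|b IHb|b IHb c IHc|b IHb c IHc|b IHb c IHc|t b IHb|t b IHb]
  d Y oY /=.
- by apply: ucomp_eq; apply: ucomp_teval oY.
- by apply: ucomp_neg; apply: IHb oY.
- by apply: ucomp_and; [apply: IHb oY|apply: IHc oY].
- by apply: ucomp_or; [apply: IHb oY|apply: IHc oY].
- by apply: ucomp_imp; [apply: IHb oY|apply: IHc oY].
(* The bound variable is the second half of the argument, and the body is evaluated at an instance
   with one more number. *)
all: have oY' := uinst_add (uinst_comp oY (ucomp_fst (ucomp_id o)))
                           (ucomp_snd (ucomp_id o)).
all: have oT := ucomp_succ (ucomp_teval t oY).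
all: pose B i n j := beval (add_num (Y i n) j) b.
- exact: (ucomp_all (B := B)) (IHb _ _ oY') oT.
- exact: (ucomp_has (B := B)) (IHb _ _ oY') oT.
Qed.

(** Decoding an instance from the oracle; knowing [d] is what locates the functions in the code. *)
Lemma uinst_encode d (X : I -> instance) :
    (forall i, size (nums (X i)) = d) -> ucomp o (fun i => encode (X i)) ->
  uinst d (fun i _ => X i).
Proof.
move=> sX oX; split=> //.
  have oX' := ucomp_comp oX (ucomp_snd (ucomp_id o)).
  have: ucomp o (fun i p => if sndn p < d then encode (X i) (sndn p) else 0).
    by ucomp.
  apply: ucomp_ext => i p; rewrite encodeE sX; case: ltnP => // le_d.
  by rewrite nth_default ?sX.
have: ucomp o (fun i p => encode (X i) (d + sndn p)).
  by apply: (ucomp_comp oX); ucomp.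
by apply: ucomp_ext => i p; rewrite encodeE sX ltnNge leq_addr addKn.
Qed.

Lemma uinst_fun F : ucomp o F -> uinst 0 (fun i _ => Instance [::] [:: F i]).
Proof.
move=> oF; split=> //=.
  by apply: ucomp_ext (ucomp_const o 0) => i n; rewrite nth_nil.
have: ucomp o (fun i p => if fstn (sndn p) == 0 then F i (sndn (sndn p)) else 0).
  by have oF' := ucomp_comp oF (ucomp_snd (ucomp_snd (ucomp_id o))); ucomp.
apply: ucomp_ext => i n; case: (fstn (sndn n)) => // j.
by rewrite /fun_nth /= nth_nil.
Qed.

End Instances.

Ltac uinst_step := first
  [ ucomp_step | simple apply uinst_add | simple eapply ucomp_encode
  | simple eapply ucomp_beval
  | match goal with H : _ |- uinst _ _ _ => simple apply H end ].

(** This serves to show that the tree built from an instance is computable. The finitely many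
    programs for the functions of [x] are glued into one by a case distinction on the index. *)
Lemma uinst_computable x :
    (forall j, j < size (funs x) -> computable (fun_nth (funs x) j)) ->
  uinst (fun=> fun=> 0) (size (nums x)) (fun (_ : unit) _ => x).
Proof.
move=> cx; set o := fun=> _.
suff nF m : m <= size (funs x) ->
    ucomp o (fun _ p =>
      if fstn p < m then fun_nth (funs x) (fstn p) (sndn p) else 0).
  split=> //.
    elim: (nums x) => [|n ns IHn].
      by apply: ucomp_ext (ucomp_const o 0) => i n; rewrite nth_nil.
    have oN : ucomp o (fun _ p => nth 0 ns (sndn p).-1).
      have oP := ucomp_pred (ucomp_snd (ucomp_id o)).
      have := ucomp_comp IHn (ucomp_pair (ucomp_const o 0) oP).
      by apply: ucomp_ext => i p; rewrite pairnK.
    have: ucomp o (fun _ p => if sndn p == 0 then n else nth 0 ns (sndn p).-1).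
      by ucomp.
    by apply: ucomp_ext => i p; case: (sndn p).
  have := ucomp_comp (nF _ (leqnn _)) (ucomp_snd (ucomp_id o)).
  apply: ucomp_ext => i p; case: ltnP => // le_s.
  by rewrite /fun_nth nth_default.
elim: m => [|m IHm] lt_m; first exact: ucomp_const.
have [c oc] := cx m lt_m.
have oF : ucomp o (fun=> fun_nth (funs x) m) by exists c.
have: ucomp o (fun _ p => if fstn p == m then fun_nth (funs x) m (sndn p)
  else if fstn p < m then fun_nth (funs x) (fstn p) (sndn p) else 0).
  apply: ucomp_if; [by ucomp| |exact: IHm (ltnW lt_m)].
  exact: ucomp_comp oF (ucomp_snd (ucomp_id o)).
by apply: ucomp_ext => i p; rewrite ltnS [in RHS]leq_eqVlt; case: eqVneq => [->|].
Qed.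

(** * Rows, tails and joins *)

Lemma row_unrow G n : row (unrow G) n = G n.
Proof. by apply: functional_extensionality => m; apply: unrowE. Qed.

Lemma tail_consb t a : tail (consb t a) = a.
Proof. by []. Qed.

Lemma ucomp_joinl (I : Type) (a b : I -> baire) :
  ucomp (fun i => joinb (a i) (b i)) a.
Proof.
set o := fun i => _; have oD := ucomp_add (ucomp_id o) (ucomp_id o).
apply: ucomp_ext (ucomp_comp (ucomp_oracle (ucomp_id o)) oD) => i n.
by rewrite /o /joinb addnn odd_double doubleK.
Qed.

Lemma ucomp_joinr (I : Type) (a b : I -> baire) :
  ucomp (fun i => joinb (a i) (b i)) b.
Proof.
set o := fun i => _; have oD := ucomp_succ (ucomp_add (ucomp_id o) (ucomp_id o)).
apply: ucomp_ext (ucomp_comp (ucomp_oracle (ucomp_id o)) oD) => i n.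
by rewrite /o /joinb addnn /= odd_double uphalf_double.
Qed.

Lemma ucomp_join (I : Type) (o a b : I -> baire) :
  ucomp o a -> ucomp o b -> ucomp o (fun i => joinb (a i) (b i)).
Proof.
move=> oa ob; have oH := ucomp_half (ucomp_id o).
exact: ucomp_if (ucomp_odd (ucomp_id o)) (ucomp_comp ob oH) (ucomp_comp oa oH).
Qed.

(** * Reductions *)

Lemma join_code c1 c2 : exists c, forall o a b,
  maps_to c1 o a -> maps_to c2 o b -> maps_to c o (joinb a b).
Proof.
(* The index set consists of the triples on which both programs are defined, so that the closure of
   [ucomp] applies to partial functionals. *)
pose I := {i : baire * baire * baire |
  maps_to c1 i.1.1 i.1.2 /\ maps_to c2 i.1.1 i.2}.
have [||c oc] := @ucomp_join I (fun i => (sval i).1.1) (fun i => (sval i).1.2)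
                            (fun i => (sval i).2).
- by exists c1; case=> i [].
- by exists c2; case=> i [].
by exists c => o a b oa ob; apply: (oc (exist _ (o, a, b) (conj oa ob))).
Qed.

Lemma fst_code : exists c, forall a b, maps_to c (joinb a b) a.
Proof.
have [c oc] := @ucomp_joinl (baire * baire) fst snd.
by exists c => a b; apply: (oc (a, b)).
Qed.

Lemma snd_code : exists c, forall a b, maps_to c (joinb a b) b.
Proof.
have [c oc] := @ucomp_joinr (baire * baire) fst snd.
by exists c => a b; apply: (oc (a, b)).
Qed.

(** The witness functionals of the second reduction need the code of the middle instance; it is
    recomputed from the code of [x] by [eta1]. *)
Lemma reduces_via_trans eta1 eta2 p q r :
    reduces_via eta1 p q -> reduces_via eta2 q r ->
  reduces_via (subst_oracle eta1 eta2) p r.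
Proof.
move=> [rm1 [rp1 red1]] [rm2 [rp2 red2]].
have [fc fcP] := fst_code; have [sc scP] := snd_code.
have [jm jmP] := join_code rm1 (subst_oracle sc eta1).
have [je jeP] := join_code fc (subst_oracle sc eta1).
have [jp jpP] := join_code (subst_oracle je rp2) sc.
exists (subst_oracle jm rm2), (subst_oracle jp rp1) => x px.
have [y [qy xy pq rm1P rp1P]] := red1 x px.
have [z [rz yz qr rm2P rp2P]] := red2 y qy.
have oy a : maps_to (subst_oracle sc eta1) (joinb a (encode x)) (encode y).
  exact: maps_to_subst (scP _ _) xy.
exists z; split=> //.
- exact: maps_to_subst xy yz.
- by rewrite pq.
- move=> a /rm1P[b [ab /rm2P[c [bc rc]]]]; exists c; split=> //.
  exact: maps_to_subst (jmP _ _ _ ab (oy a)) bc.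
- move=> c /rp2P[b [cb /rp1P[a [ba pa]]]]; exists a; split=> //.
  apply: maps_to_subst ba; apply: jpP (scP _ _).
  exact: maps_to_subst (jeP _ _ _ (fcP _ _) (oy c)) cb.
Qed.

Lemma dm_reducible_trans p q r :
  dm_reducible p q -> dm_reducible q r -> dm_reducible p r.
Proof.
move=> [eta1 [red1 dred1]] [eta2 [red2 dred2]].
by exists (subst_oracle eta1 eta2); split; [apply: reduces_via_trans red1 red2
                                           |apply: reduces_via_trans dred1 dred2].
Qed.

(** * Functionals of a witness and an instance *)

Section Witnesses.
Variable N : nat.
Let J : Type := baire * {x : instance | size (nums x) = N}.

Definition ucomp_wit (R : baire -> instance -> baire) : Prop :=
  ucomp (fun i : J => joinb i.1 (encode (sval i.2))) (fun i => R i.1 (sval i.2)).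

Lemma ucomp_wit_oracle H :
    ucomp (fun i : J => joinb i.1 (encode (sval i.2))) H ->
  ucomp (fun i : J => joinb i.1 (encode (sval i.2))) (fun i n => i.1 (H i n)).
Proof. exact: ucomp_comp (ucomp_joinl _ _). Qed.

Lemma uinst_wit :
  uinst (fun i : J => joinb i.1 (encode (sval i.2))) N (fun i _ => sval i.2).
Proof. by apply: uinst_encode (ucomp_joinr _ _) => i; apply: (svalP i.2). Qed.

End Witnesses.

Ltac ucomp_eta :=
  match goal with
  | |- ucomp ?o ?F =>
    let F' := eval cbv beta in (fun i n => F i n) in change (ucomp o F')
  end.
Ltac solve_ucomp_wit := ucomp_eta; solve [repeat first
  [ uinst_step | simple apply ucomp_wit_oracle | simple apply uinst_wit ]].

(** With total functions for the three functionals, computability and correctness become separate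
    goals. *)
Lemma reduces_via_intro eta p q f Rm Rp :
    (forall x, is_instance p x -> is_instance q (f x)) ->
    (forall x, is_instance p x -> maps_to eta (encode x) (encode (f x))) ->
    (forall x, is_instance p x -> true_at p x <-> true_at q (f x)) ->
    ucomp_wit (n_num p) Rm -> ucomp_wit (n_num p) Rp ->
    (forall x a, is_instance p x ->
      witnesses a p x -> witnesses (Rm a x) q (f x)) ->
    (forall x a, is_instance p x ->
      witnesses a q (f x) -> witnesses (Rp a x) p x) ->
  reduces_via eta p q.
Proof.
move=> qf etaf pqf [rm rmP] [rp rpP] pRm qRp; exists rm, rp => x px.
have [sx _ _ _] := px; exists (f x); split; [exact: qf|exact: etaf|exact: pqf| |].
- move=> a pa; exists (Rm a x); split; last exact: pRm.
  exact: (rmP (a, exist (fun x => size (nums x) = n_num p) x sx)).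
- move=> a qa; exists (Rp a x); split; last exact: qRp.
  exact: (rpP (a, exist (fun x => size (nums x) = n_num p) x sx)).
Qed.

(** * Exchanging the existential quantifier of [FinBranch] for [AllInf] *)

Definition is_many_children (T : baire) (s k c : nat) : Prop :=
  [/\ T s = 1, forall i, i <= k -> T (snoc s (entry c i)) = 1
    & forall i j, i <= k -> j <= k -> entry c i = entry c j -> i = j].

Lemma FinBranch_matrixPn T s k c :
  reflect (is_many_children T s k c)
    (~~ beval (Instance [:: s; k; c] [:: T]) (matrix FinBranch)).
Proof.
(* [e] is [entry] in the form in which the term [tentry] evaluates, pairing included; this makes the
   matrix convertible to the expression below. *)
pose r := iota 0 k.+1; pose e i := entry (fstn (pairn c i)) (sndn (pairn c i)).
have eE i : e i = entry c i by rewrite /e !pairnK.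
have rE i : (i \in r) = (i <= k) by rewrite mem_iota.
rewrite -[beval _ _]/[==> T s == 1, all (fun i => T (snoc s (e i)) == 1) r
  => has (fun i => has (fun j => ~~ (i == j) && (e i == e j)) r) r].
rewrite !negb_imply; clearbody r.
apply: (iffP and3P) => [[/eqP Ts /allP Tc /hasPn cI]|[Ts Tc cI]]; split.
- exact: Ts.
- by move=> i; rewrite -rE => /Tc/eqP; rewrite eE.
- move=> i j; rewrite -!rE => /cI/hasPn cIi /cIi; rewrite !eE => eq_j eq_ij.
  by move: eq_j; rewrite eq_ij eqxx andbT negbK => /eqP.
- exact/eqP.
- by apply/allP=> i; rewrite rE eE => /Tc/eqP.
- apply/hasPn=> i; rewrite rE => le_i; apply/hasPn=> j; rewrite rE !eE => le_j.
  by apply/negP=> /andP[/eqP neq_ij /eqP/(cI _ _ le_i le_j)].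
Qed.

(** The same [c] serves, because a number codes tuples of every length, each an initial part of the
    longer ones. *)
Lemma many_childrenW T s k k' c :
  k <= k' -> is_many_children T s k' c -> is_many_children T s k c.
Proof.
move=> le_k [Ts Tc cI]; split=> // [i le_i|i j le_i le_j].
  exact/Tc/(leq_trans le_i).
by apply: cI; apply: leq_trans le_k.
Qed.

(** Its instances are arbitrary functions, not only trees, as a strictly dicomplete formula has an
    unrestricted domain. *)
Definition FinBranch' : formula :=
  Formula [:: All; AllInf; All] (matrix FinBranch) 0 1 (fun=> True).

Lemma dm_FinBranch_AllInf : dm_reducible FinBranch FinBranch'.
Proof.
pose mx := matrix FinBranch.
pose fin x s k c := encode (add_num3 x s k c).
have shape x : is_instance FinBranch x -> exists T, x = Instance [::] [:: T].
  by case: x => [[|n ns] [|T [|U fs]]] [] //= *; exists T.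
have mxW x s k k' c : is_instance FinBranch x -> k <= k' ->
    beval (add_num3 x s k c) mx ->
    beval (add_num3 x s k' c) mx.
  move=> /shape[T ->] le_k; apply: contraLR => /FinBranch_matrixPn chi.
  exact/FinBranch_matrixPn/(many_childrenW le_k).
have inst x : is_instance FinBranch x -> is_instance FinBranch' x.
  by case=> ? ? ? _; split.
have oid x : is_instance FinBranch x -> maps_to COracle (encode x) (encode x).
  by move=> _ n; apply: eval_oracle.
exists COracle; split.
(* A witness for the bounded matrix is the code of the extended instance and can be recomputed; only
   the bound [a (pairn s 0)] is read from [a]. *)
- pose Rm a x := unrow (fun s => consb (a (pairn s 0))
    (unrow (fun k => unrow (fun c => fin x s k c)))).
  pose Rp a x := unrow (fun s => consb (a (pairn s 0))
    (unrow (fun c => fin x s (a (pairn s 0)) c))).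
  apply: (@reduces_via_intro _ _ _ id Rm Rp) => //.
  + move=> x px; rewrite /true_at [Defs.prefix _]/= [Defs.prefix _]/=;
    split=> fb s; have [k kP] := fb s; exists k => //.
      by move=> k' le_k c; apply: mxW (kP c).
    exact: kP.
  + by rewrite /ucomp_wit /Rm /fin; solve_ucomp_wit.
  + by rewrite /ucomp_wit /Rp /fin; solve_ucomp_wit.
  + move=> x a px; rewrite /witnesses [Defs.prefix _]/= [Defs.prefix _]/= => fb s.
    rewrite /Rm row_unrow tail_consb => k le_k c; rewrite !row_unrow.
    by split=> //; have [_] := fb s c; apply: mxW.
  + move=> x a px; rewrite /witnesses [Defs.prefix _]/= [Defs.prefix _]/= => fb s c.
    rewrite /Rp row_unrow tail_consb row_unrow; split=> //.
    by have [] := fb s _ (leqnn _) c.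
(* In the dual, [Rm] answers [k] with [k] itself, and [Rp] keeps the tuple given for some number at
   least [k]. That number sits at index 0 of the row, hence the tuple at index 1. *)
- pose Rm a x := consb (a 0) (unrow (fun k => consb k (consb (a (pairn k 0).+1)
    (fin x (a 0) k (a (pairn k 0).+1))))).
  pose Rp a x := consb (a 0) (unrow (fun k => consb (a (pairn k 1).+1)
    (fin x (a 0) k (a (pairn k 1).+1)))).
  apply: (@reduces_via_intro _ _ _ id Rm Rp) => //.
  + move=> x px; rewrite /true_at [Defs.prefix _]/= [Defs.prefix _]/=;
    split=> [][s fb]; exists s => k.
      by have [c cP] := fb k; exists k; split=> //; exists c.
    have [k' [le_k [c cP]]] := fb k; exists c.
    by move: cP; apply: contra; apply: mxW.
  + by rewrite /ucomp_wit /Rm /fin; solve_ucomp_wit.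
  + by rewrite /ucomp_wit /Rp /fin; solve_ucomp_wit.
  + move=> x a px; rewrite /witnesses [Defs.prefix _]/= [Defs.prefix _]/= => fb k.
    rewrite /Rm !tail_consb row_unrow; split=> //; split=> //.
    by have [] := fb k.
  + move=> x a px; rewrite /witnesses [Defs.prefix _]/= [Defs.prefix _]/= => fb k.
    rewrite /Rp !tail_consb row_unrow; split=> //.
    by have [le_k [_]] := fb k; apply: contra; apply: mxW.
Qed.

(** * The tree of an AllInf formula *)

Definition spine (a : nat) : nat := iter a (snoc^~ 0) 0.
(** The search may stop at [s] because [a <= spine a]. Off the spine it fails with value [s.+1], so
    that [spine (depth s) == s] decides membership in the spine. *)
Definition depth (s : nat) : nat := find (fun a => spine a == s) (iota 0 s.+1).

Lemma snoc_gt s n : s < snoc s n.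
Proof.
by rewrite /snoc ltnS /pairn; have := Cantor.to_nat_non_decreasing s n; lia.
Qed.

Lemma spine_mono : {homo spine : a b / a < b}.
Proof. by apply: homo_ltn => [? ? ?|a]; [apply: ltn_trans|apply: snoc_gt]. Qed.

Lemma depthK : cancel spine depth.
Proof.
move=> a; have le_a : a <= spine a.
  by elim: a => // a IHa; apply: leq_ltn_trans IHa (spine_mono (ltnSn a)).
have a_spine : has (fun a' => spine a' == spine a) (iota 0 (spine a).+1).
  by apply/hasP; exists a; rewrite ?mem_iota.
have := a_spine; rewrite has_find size_iota => lt_d.
have := nth_find 0 a_spine; rewrite nth_iota // add0n -/(depth _) => /eqP eq_d.
by case: (ltngtP (depth (spine a)) a) => // /spine_mono; rewrite eq_d ltnn.
Qed.


(** * Children of the spine nodes *)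

Section SpineTree.
Variable bad : nat -> nat -> nat -> bool.

Definition triggers (a i e : nat) : bool :=
  bad a (fstn e) (sndn e) && (i <= fstn e).

Definition first_trigger (a i e : nat) : bool :=
  triggers a i e && all (fun e' => ~~ triggers a i e') (iota 0 e).

(** The number 0 codes the root; otherwise [m.-1] is the pair of the parent and the last entry.
    Entry 0 continues the spine, and entry [(pairn i e).+1] is the child for [i]. *)
Definition spine_tree : baire := fun m =>
  (m == 0) || (spine (depth (fstn m.-1)) == fstn m.-1) &&
    ((sndn m.-1 == 0) || first_trigger (depth (fstn m.-1))
                           (fstn (sndn m.-1).-1) (sndn (sndn m.-1).-1)).

Lemma spine_tree_snoc s n : spine_tree (snoc s n) =
  (spine (depth s) == s) &&
    ((n == 0) || first_trigger (depth s) (fstn n.-1) (sndn n.-1)).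
Proof. by rewrite /spine_tree /snoc /= !pairnK. Qed.

Lemma is_tree_spine_tree : is_tree spine_tree.
Proof.
split=> [m|s u]; first exact: leq_b1.
(* The entries of [u] are removed one at a time: a node other than the root has its parent on the
   spine, and every spine node is in the tree. *)
elim/last_ind: u => [|u n IHu]; first by rewrite cats0.
rewrite -rcons_cat /seq_code foldl_rcons -/(seq_code (s ++ u)) => sun; apply: IHu.
move: sun; rewrite spine_tree_snoc; case: eqP => //= <- _.
case: (depth _) => // d; rewrite -[spine d.+1]/(snoc (spine d) 0).
by rewrite spine_tree_snoc depthK eqxx.
Qed.

(** Minimality leaves each [i] at most one child; the counting of children rests on this. *)
Lemma first_trigger_inj a i e e' :
  first_trigger a i e -> first_trigger a i e' -> e = e'.
Proof.
move=> /andP[te /allP me] /andP[te' /allP me']; case: (ltngtP e e') => // lt_e.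
  by have := me' e; rewrite mem_iota te => /(_ lt_e).
by have := me e'; rewrite mem_iota te' => /(_ lt_e).
Qed.

(** Any known trigger bounds the search for the least one. *)
Lemma first_trigger_find a i e :
  triggers a i e -> first_trigger a i (find (triggers a i) (iota 0 e.+1)).
Proof.
move=> te; have ht : has (triggers a i) (iota 0 e.+1).
  by apply/hasP; exists e; rewrite ?mem_iota ?leqnn.
have := ht; rewrite has_find size_iota => lt_e.
have := nth_find 0 ht; rewrite nth_iota // add0n => tf.
rewrite /first_trigger tf; apply/allP => e'; rewrite mem_iota => lt_e'.
have := before_find 0 lt_e'; rewrite nth_iota ?add0n => [->//|].
exact: ltn_trans lt_e' lt_e.
Qed.

(** Each step pushes [f y] in front, so the tuple lists the values of [f] in reverse order. *)
Definition code_tuple (f : nat -> nat) (n : nat) : nat :=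
  nat_rec (fun=> nat) 0 (fun y r => pairn (f y) r) n.

Lemma entry_code_tuple f n j : j < n -> entry (code_tuple f n) j = f (n - j.+1).
Proof.
elim: n j => // n IHn [|j] lt_j; rewrite /entry ?iterSr /= pairnK ?subn1 //.
by rewrite -IHn.
Qed.

(** The children for [i] from [k] down to 0. A trigger [e] for [k] also triggers every smaller [i],
    so it bounds all the searches. *)
Definition many_children (a k e : nat) : nat :=
  code_tuple (fun i => (pairn i (find (triggers a i) (iota 0 e.+1))).+1) k.+1.

Lemma many_childrenP a k e :
    triggers a k e -> is_many_children spine_tree (spine a) k (many_children a k e).
Proof.
move=> /andP[bad_e le_k].
have chE j : j <= k -> entry (many_children a k e) j =
    (pairn (k - j) (find (triggers a (k - j)) (iota 0 e.+1))).+1.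
  by move=> le_j; rewrite entry_code_tuple // subSS.
split=> [|j le_j|j j' le_j le_j'].
- case: a {bad_e chE} => // a; rewrite -[spine _]/(snoc (spine a) 0) spine_tree_snoc.
  by rewrite depthK eqxx.
- rewrite chE // spine_tree_snoc depthK eqxx /= !pairnK first_trigger_find //.
  by rewrite /triggers bad_e (leq_trans (leq_subr _ _) le_k).
- by rewrite !chE // => -[] /(congr1 fstn); rewrite !pairnK; lia.
Qed.

(** The test is on the component [b] of [e], which is at least [i], so that success gives [t <= b]
    at once. Entry 0 is the spine child and carries no [e]. *)
Definition pick_trigger (t c : nat) : nat :=
  sndn (entry c (find (fun j =>
    (entry c j != 0) && (t <= fstn (sndn (entry c j).-1))) (iota 0 t.+2))).-1.

Lemma pick_triggerP s t c : is_many_children spine_tree s t.+1 c ->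
  spine (depth s) = s /\ triggers (depth s) t (pick_trigger t c).
Proof.
(* Having a child in the tree already puts [s] on the spine. *)
move=> [_ Tc cI]; have := Tc 0 isT; rewrite spine_tree_snoc.
case: eqP => // sp _; split=> //.
have {}Tc j : j <= t.+1 -> (entry c j == 0) || first_trigger (depth s)
    (fstn (entry c j).-1) (sndn (entry c j).-1).
  by move/Tc; rewrite spine_tree_snoc sp eqxx; case: (_ || _).
rewrite /pick_trigger; set Q := fun j => _.
have [hQ|/hasPn nQ] := boolP (has Q (iota 0 t.+2)).
  have := hQ; rewrite has_find size_iota => lt_Q.
  have := nth_find 0 hQ; rewrite nth_iota // add0n; set j := find _ _.
  move=> /andP[cj le_t]; have := Tc j lt_Q; rewrite (negPf cj) => /andP[/andP[]].
  by rewrite /triggers le_t => ->.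
(* Otherwise every child in the tuple is 0 or the child of some i < t, so that
   two of the t + 2 of them are equal. *)
pose h j := if entry c j == 0 then 0 else (fstn (entry c j).-1).+1.
(* For a child other than 0, [i] determines [e] and hence the child. *)
have hI : {in iota 0 t.+2 &, injective h}.
  move=> j j'; rewrite !mem_iota => le_j le_j' eq_h; apply: cI => //.
  have := Tc j le_j; have := Tc j' le_j'; move: eq_h; rewrite /h.
  case: (entry c j) => [|u]; case: (entry c j') => [|v] //= [eq_uv] fv fu.
  rewrite -(fst_sndnK u) -(fst_sndnK v) eq_uv; congr (pairn _ _).+1.
  by rewrite eq_uv in fu; apply: first_trigger_inj fu fv.
have /uniq_leq_size : uniq (map h (iota 0 t.+2)).
  by rewrite map_inj_in_uniq ?iota_uniq.
move/(_ (iota 0 t.+1)); rewrite size_map !size_iota ltnn => /(_ _)/negP[] //.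
move=> _ /mapP[j lt_j ->]; rewrite mem_iota /= /h; case: eqP => // /eqP cj.
have := nQ j lt_j; rewrite /Q cj -ltnNge /=; apply: leq_ltn_trans.
by move: lt_j; rewrite mem_iota => /Tc; rewrite (negPf cj) => /andP[/andP[_]].
Qed.

End SpineTree.

(** * Computability of the tree and of the maps between bad pairs and tuples *)

Section SpineTreeComp.
Variables (I : Type) (o : I -> baire) (bad : I -> nat -> nat -> nat -> bool).
Hypothesis o_bad : ucomp o (fun i p =>
  bad i (fstn p) (fstn (sndn p)) (sndn (sndn p))).

Lemma ucomp_spine F : ucomp o F -> ucomp o (fun i n => spine (F i n)).
Proof.
move=> oF; have: ucomp o (fun i n =>
  nat_rec (fun=> nat) 0 (fun _ r => snoc r 0) (F i n)) by rewrite /snoc; ucomp.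
by apply: ucomp_ext => i n; elim: (F i n) => //= m ->.
Qed.

Lemma ucomp_depth F : ucomp o F -> ucomp o (fun i n => depth (F i n)).
Proof.
move=> oF; have oF' := ucomp_comp oF (ucomp_fst (ucomp_id o)).
by rewrite /depth; have oS := ucomp_spine; ucomp.
Qed.

Lemma ucomp_bad F G H :
    ucomp o F -> ucomp o G -> ucomp o H ->
  ucomp o (fun i n => bad i (F i n) (G i n) (H i n)).
Proof.
move=> oF oG oH; have := ucomp_comp o_bad (ucomp_pair oF (ucomp_pair oG oH)).
by apply: ucomp_ext => i n; rewrite !pairnK.
Qed.

Lemma ucomp_triggers F G H :
    ucomp o F -> ucomp o G -> ucomp o H ->
  ucomp o (fun i n => triggers (bad i) (F i n) (G i n) (H i n)).
Proof. by move=> oF oG oH; have oB := ucomp_bad; rewrite /triggers; ucomp. Qed.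

Lemma ucomp_spine_tree : ucomp o (fun i => spine_tree (bad i)).
Proof.
rewrite /spine_tree /first_trigger.
by have oT := ucomp_triggers; have oS := ucomp_spine; have oD := ucomp_depth; ucomp.
Qed.

Lemma ucomp_many_children F G H :
    ucomp o F -> ucomp o G -> ucomp o H ->
  ucomp o (fun i n => many_children (bad i) (F i n) (G i n) (H i n)).
Proof.
move=> oF oG oH.
(* Inside the recursion and the search the original argument is a component of a pair, so [F] and
   [H] are needed at other computable arguments. *)
have oF' := fun H' => @ucomp_comp _ _ _ H' oF.
have oH' := fun H' => @ucomp_comp _ _ _ H' oH.
by have oT := ucomp_triggers; rewrite /many_children /code_tuple; ucomp.
Qed.

Lemma ucomp_pick_trigger F G :
    ucomp o F -> ucomp o G ->
  ucomp o (fun i n => pick_trigger (F i n) (G i n)).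
Proof.
move=> oF oG.
have oF' := fun H' => @ucomp_comp _ _ _ H' oF.
have oG' := fun H' => @ucomp_comp _ _ _ H' oG.
have oE H1 H2 : ucomp o H1 -> ucomp o H2 ->
    ucomp o (fun i n => entry (H1 i n) (H2 i n)).
  move=> o1 o2; have := ucomp_primrec primrec_entry (ucomp_pair o1 o2).
  by apply: ucomp_ext => i n; rewrite !pairnK.
by rewrite /pick_trigger; ucomp.
Qed.

End SpineTreeComp.

(** * Reduction of arbitrary formulas to [FinBranch], and completeness *)

Lemma dm_reducible_FinBranch p :
  is_Qformula [:: All; AllInf; All] p -> dm_reducible p FinBranch.
Proof.
case: p => _ mx N K dom [/= -> domT].
pose p := Formula [:: All; AllInf; All] mx N K dom; rewrite -/p.
pose bad x a b c := ~~ beval (add_num3 x a b c) mx.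
pose f x := Instance [::] [:: spine_tree (bad x)].
pose fx x a b c := encode (add_num3 x a b c).
pose fy x s k c := encode (add_num3 (f x) s k c).
have badP I (o : I -> baire) X : uinst o N (fun i _ => X i) ->
    ucomp o (fun i q => bad (X i) (fstn q) (fstn (sndn q)) (sndn (sndn q))).
  by move=> oX; rewrite /bad; solve [repeat uinst_step].
have treeP I (o : I -> baire) X : uinst o N (fun i _ => X i) ->
    uinst o 0 (fun i _ => f (X i)).
  move=> /badP oB.
  exact: uinst_fun (@ucomp_spine_tree _ _ (fun i => bad (X i)) oB).
have inst x : is_instance p x -> is_instance FinBranch (f x).
  move=> [sx kx cx _]; split=> //; last exact: is_tree_spine_tree.
  case=> // _; rewrite /= in sx kx cx.
  (* Index type [unit] and the zero oracle turn uniform computability into computability of the one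
     tree. *)
  have [|c oc] := @ucomp_spine_tree unit (fun=> fun=> 0) (fun=> bad x); last first.
    by exists c; apply: (oc tt).
  apply: (badP _ _ (fun=> x)); rewrite -sx; apply: uinst_computable.
  by rewrite kx.
have [|eta etaP] := @ucomp_encode {x | size (nums x) = N}
    (fun i => encode (sval i)) 0 (fun i _ => f (sval i)) (fun _ n => n) _ (ucomp_id _).
  apply: treeP; apply: uinst_encode; first exact: svalP.
  by exists COracle => i n; apply: eval_oracle.
have {}etaP x : is_instance p x -> maps_to eta (encode x) (encode (f x)).
  by move=> [sx _ _ _]; apply: (etaP (exist _ x sx)).
have oX := uinst_wit N; have oY := treeP _ _ _ oX.
have oM := @ucomp_many_children _ _ (fun i => bad (sval i.2)) (badP _ _ _ oX).
have oS := ucomp_spine; have oD := ucomp_depth; have oP := ucomp_pick_trigger.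
have fbP x s k c : reflect (is_many_children (spine_tree (bad x)) s k c)
    (~~ beval (add_num3 (f x) s k c) (matrix FinBranch)).
  exact: FinBranch_matrixPn.
(* Both the reduction and its dual rest on this fact and on its converse [fb_bad]. The converse
   passes from [t.+1] to [t] because of the spine child. *)
have bad_fb x a b c k : bad x a b c -> k <= b ->
    ~~ beval (add_num3 (f x) (spine a) k
                (many_children (bad x) a k (pairn b c))) (matrix FinBranch).
  move=> bad_c le_k; apply/fbP/many_childrenP.
  by rewrite /triggers !pairnK bad_c.
have fb_bad x s t c :
    ~~ beval (add_num3 (f x) s t.+1 c) (matrix FinBranch) ->
  let e := pick_trigger t c in
  t <= fstn e /\ bad x (depth s) (fstn e) (sndn e).
  by move=> /fbP/pick_triggerP[_ /andP[]].
exists eta; split.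
(* A threshold [t] leaves at most [t + 1] children: one for each [i < t] and the spine child. Off
   the spine [depth s] has no meaning, but such a node has no children and every bound is
   correct. *)
- pose Rm a x := unrow (fun s => consb (a (pairn (depth s) 0)).+1
    (unrow (fun c => fy x s (a (pairn (depth s) 0)).+1 c))).
  (* A bound [k] at the node [spine u] is itself a threshold, as a bad [b >= k] would yield [k + 1]
     children. *)
  pose Rp a x := unrow (fun u => consb (a (pairn (spine u) 0))
    (unrow (fun v => unrow (fun w => fx x u v w)))).
  have mxS x s t c :
      (forall b, t <= b -> forall c, beval (add_num3 x (depth s) b c) mx) ->
      beval (add_num3 (f x) s t.+1 c) (matrix FinBranch).
    move=> good; apply: contraT => /fb_bad[le_t].
    by rewrite /bad good.
  have mxP x u k b w : k <= b ->
      (forall c, beval (add_num3 (f x) (spine u) k c) (matrix FinBranch)) ->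
      beval (add_num3 x u b w) mx.
    move=> le_k good; apply: contraT => /bad_fb/(_ le_k).
    by rewrite good.
  apply: (@reduces_via_intro _ _ _ f Rm Rp) => //.
  + move=> x px; rewrite /true_at [Defs.prefix _]/= [Defs.prefix _]/=; split=> hx.
      move=> s; have [t tP] := hx (depth s); exists t.+1 => c; exact: mxS.
    move=> u; have [k kP] := hx (spine u); exists k => b le_k w; exact: mxP kP.
  + by rewrite /ucomp_wit /Rm /fy; solve_ucomp_wit.
  + by rewrite /ucomp_wit /Rp /fx; solve_ucomp_wit.
  + move=> x a px; rewrite /witnesses [Defs.prefix _]/= [Defs.prefix _]/=
      => hx s c.
    rewrite /Rm row_unrow tail_consb row_unrow; split=> //; apply: mxS.
    by move=> b le_b {}c; have [] := hx (depth s) b le_b c.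
  + move=> x a px; rewrite /witnesses [Defs.prefix _]/= [Defs.prefix _]/=
      => hx u.
    rewrite /Rp row_unrow tail_consb => v le_v w; rewrite !row_unrow; split=> //.
    by apply: mxP le_v _ => c; have [] := hx (spine u) c.
(* In row [k] of the tail of a dual witness, indices 0 and 1 hold a bad pair with [b >= k]. *)
- pose ch a x k := many_children (bad x) (a 0) k
                     (pairn (a (pairn k 0).+1) (a (pairn k 1).+1)).
  pose Rm a x := consb (spine (a 0)) (unrow (fun k =>
    consb (ch a x k) (fy x (spine (a 0)) k (ch a x k)))).
  (* A bad pair with [b >= n] is extracted from the tuple that refutes the bound [n.+1]. *)
  pose e (a : baire) n := pick_trigger n (a (pairn n.+1 0).+1).
  pose Rp a x := consb (depth (a 0)) (unrow (fun n =>
    consb (fstn (e a n)) (consb (sndn (e a n))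
      (fx x (depth (a 0)) (fstn (e a n)) (sndn (e a n)))))).
  apply: (@reduces_via_intro _ _ _ f Rm Rp) => //.
  + move=> x px; rewrite /true_at [Defs.prefix _]/= [Defs.prefix _]/=;
    split=> [][a hx].
      exists (spine a) => k; have [b [le_k [c bc]]] := hx k.
      by exists (many_children (bad x) a k (pairn b c)); apply: bad_fb bc le_k.
    exists (depth a) => t; have [c /fb_bad[le_t bc]] := hx t.+1.
    exists (fstn (pick_trigger t c)); split=> //.
    by exists (sndn (pick_trigger t c)).
  + by rewrite /ucomp_wit /Rm /ch /fy; solve_ucomp_wit.
  + by rewrite /ucomp_wit /Rp /e /fx; solve_ucomp_wit.
  + move=> x a px; rewrite /witnesses [Defs.prefix _]/= [Defs.prefix _]/=
      => hx k.
    rewrite /Rm !tail_consb row_unrow; split=> //.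
    by have [le_k [_ bc]] := hx k; apply: bad_fb bc le_k.
  + move=> x a px; rewrite /witnesses [Defs.prefix _]/= [Defs.prefix _]/=
      => hx n.
    have [_ /fb_bad[le_n bc]] := hx n.+1.
    by rewrite /Rp !tail_consb row_unrow; split=> //; split.
Qed.

Theorem proposition3p4 : dicomplete [:: All; AllInf; All] FinBranch.
Proof.
(* [FinBranch'] has the required prefix, so it reduces to [FinBranch] like any other such formula;
   conversely it is complete because every such formula reduces to it through [FinBranch]. *)
exists FinBranch'; split; last first.
  split; first exact: dm_FinBranch_AllInf.
  exact: dm_reducible_FinBranch.
split=> // p /dm_reducible_FinBranch pF.
exact: dm_reducible_trans pF dm_FinBranch_AllInf.
Qed.
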